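(* Let $n$ be a positive integer, let $V_{8n} = \langle a, b \mid a^{2n} = b^{4} = 1,\ ba = a^{-1}b^{-1},\ b^{-1}a = a^{-1}b \rangle$, and let $\mathbb{F}$ be a field. Then $\mathrm{Der}_{\mathrm{inn}}(\mathbb{F}V_{8n})$ has dimension $6(n-1)$ over $\mathbb{F}$ if $n$ is even and $3(2n-1)$ if $n$ is odd. (i) When $n$ is even, a basis for $\mathrm{Der}_{\mathrm{inn}}(\mathbb{F}V_{8n})$ over $\mathbb{F}$ is $$\begin{aligned} \mathcal{B}_{1} = \{d_{g} \mid g \in\ & \{a^{2k},\ a^{2k}b^{2},\ a^{4k}b^{-1},\ a^{4k+1}b^{-1},\ a^{4k+2}b^{-1},\ a^{4k+3}b^{-1} \mid 1 \leq k \leq \tfrac{n}{2}-1\} \\ & \cup \{a^{2k-1} \mid 1 \leq k \leq n\} \cup \{a^{4k}b,\ a^{4k+1}b,\ a^{4k+2}b,\ a^{4k+3}b \mid 1 \leq k \leq \tfrac{n}{2}\}\}. \end{aligned}$$ (ii) When $n$ is odd, a basis for $\mathrm{Der}_{\mathrm{inn}}(\mathbb{F}V_{8n})$ over $\mathbb{F}$ is $$\begin{aligned} \mathcal{B}_{2} = \{d_{g} \mid g \in\ & \{a^{2k},\ a^{2k}b^{2} \mid 1 \leq k \leq \tfrac{n-1}{2}\} \cup \{a^{2k-1},\ a^{2k}b,\ a^{2k+1}b \mid 1 \leq k \leq n\} \\ & \cup \{a^{2k}b^{-1},\ a^{2k+1}b^{-1} \mid 1 \leq k \leq n-1\}\}.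 \end{aligned}$$
   Context: $V_{8n}$ has order $8n$ and $V_{8n} = \{a^{i}b^{j} \mid 0 \leq i \leq 2n-1,\ 0 \leq j \leq 3\}$; $\mathbb{F}V_{8n}$ is its group algebra over $\mathbb{F}$. For $\beta \in \mathbb{F}V_{8n}$, $d_{\beta}: \mathbb{F}V_{8n} \to \mathbb{F}V_{8n}$ is the inner derivation $d_{\beta}(\alpha) = \alpha\beta - \beta\alpha$, and $\mathrm{Der}_{\mathrm{inn}}(\mathbb{F}V_{8n}) = \{d_\beta \mid \beta \in \mathbb{F}V_{8n}\}$, an $\mathbb{F}$-vector space under pointwise operations. A set indexed by an empty range of $k$ is empty. *)

(* Defs.v *)
From HB Require Import structures.
From mathcomp Require Import all_boot all_order all_algebra all_fingroup.

Set Implicit Arguments.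
Unset Strict Implicit.
Unset Printing Implicit Defensive.

Import GRing.Theory.
Local Open Scope ring_scope.

(* The group algebra: functions gT -> F with the convolution product. The     *)
(* alias hides the pointwise ring structure of {ffun gT -> F}.                *)
Definition grpalg (F : fieldType) (gT : finGroupType) : Type :=
  {ffun gT -> F^o}.

HB.instance Definition _ (F : fieldType) (gT : finGroupType) :=
  GRing.Lmodule.copy (grpalg F gT) {ffun gT -> F^o}.
HB.instance Definition _ (F : fieldType) (gT : finGroupType) :=
  Vector.copy (grpalg F gT) {ffun gT -> F^o}.

Section GroupAlgebra.
Variables (F : fieldType) (gT : finGroupType).
Implicit Types (u v w : grpalg F gT) (x y g h : gT).

Definition ga_elt g : grpalg F gT := [ffun x => (x == g)%:R : F^o].

Definition ga_mul u v : grpalg F gT :=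
  [ffun x => \sum_(h : gT) (u h : F) * v (h^-1 * x)%g : F^o].

Fact ga_mulA : associative ga_mul.
Proof.
move=> u v w; apply/ffunP => x; rewrite !ffunE.
under eq_bigr => h _ do rewrite ffunE mulr_sumr.
under [RHS]eq_bigr => h _ do rewrite ffunE mulr_suml.
rewrite [RHS]exchange_big /=; apply: eq_bigr => h _.
rewrite [RHS](reindex_inj (mulgI h)) /=; apply: eq_bigr => k _.
by rewrite mulrA mulKg invMg mulgA.
Qed.

Fact ga_mul1l : left_id (ga_elt 1%g) ga_mul.
Proof.
move=> u; apply/ffunP => x; rewrite ffunE (bigD1 1%g) //= big1 => [|h /negPf h1].
  by rewrite ffunE eqxx mul1r invg1 mul1g addr0.
by rewrite ffunE h1 mul0r.
Qed.

Fact ga_mul1r : right_id (ga_elt 1%g) ga_mul.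
Proof.
move=> u; apply/ffunP => x; rewrite ffunE (bigD1 x) //= big1 => [|h hx].
  by rewrite ffunE mulVg eqxx mulr1 addr0.
rewrite ffunE -(inj_eq (mulgI h)) mulKVg mulg1 eq_sym (negPf hx).
by rewrite mulr0.
Qed.

Fact ga_mulDl : left_distributive ga_mul +%R.
Proof.
move=> u v w; apply/ffunP => x; rewrite !ffunE -big_split /=.
by apply: eq_bigr => h _; rewrite ffunE mulrDl.
Qed.

Fact ga_mulDr : right_distributive ga_mul +%R.
Proof.
move=> u v w; apply/ffunP => x; rewrite !ffunE -big_split /=.
by apply: eq_bigr => h _; rewrite ffunE mulrDr.
Qed.

Fact ga_1neq0 : ga_elt 1%g != 0.
Proof.
by apply/eqP => /ffunP/(_ 1%g); rewrite !ffunE eqxx => /eqP; rewrite oner_eq0.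
Qed.

HB.instance Definition _ := GRing.Zmodule_isNzRing.Build (grpalg F gT)
  ga_mulA ga_mul1l ga_mul1r ga_mulDl ga_mulDr ga_1neq0.

Fact ga_scaleAl (c : F) u v : c *: (u * v) = (c *: u) * v.
Proof.
apply/ffunP => x; rewrite !ffunE /= scaler_sumr.
by apply: eq_bigr => h _; rewrite ffunE /= scalerAl.
Qed.

HB.instance Definition _ :=
  GRing.Lmodule_isLalgebra.Build F (grpalg F gT) ga_scaleAl.

Fact ga_scaleAr (c : F) u v : c *: (u * v) = u * (c *: v).
Proof.
apply/ffunP => x; rewrite !ffunE /= scaler_sumr.
by apply: eq_bigr => h _; rewrite ffunE /= [RHS]mulrCA.
Qed.

HB.instance Definition _ :=
  GRing.Lalgebra_isAlgebra.Build F (grpalg F gT) ga_scaleAr.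

Lemma ga_eltM g h : ga_elt (g * h)%g = ga_elt g * ga_elt h.
Proof.
apply/ffunP => x; rewrite !ffunE (bigD1 g) //= big1 => [|k /negPf kg].
  by rewrite !ffunE eqxx mul1r addr0 -(inj_eq (mulgI g^-1%g)) mulKg.
by rewrite ffunE kg mul0r.
Qed.

Definition inner_fun (beta alpha : grpalg F gT) : grpalg F gT :=
  alpha * beta - beta * alpha.

Fact inner_fun_linear beta : linear (inner_fun beta).
Proof.
move=> c u v; rewrite /inner_fun mulrDl mulrDr -scalerAl -scalerAr scalerBr.
by rewrite opprD addrACA.
Qed.

HB.instance Definition _ beta :=
  GRing.isLinear.Build F (grpalg F gT) (grpalg F gT) _ (inner_fun beta)
    (inner_fun_linear beta).

Definition inner_der (beta : grpalg F gT) : 'End(grpalg F gT) :=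
  linfun (inner_fun beta).

Lemma inner_derE beta alpha :
  inner_der beta alpha = alpha * beta - beta * alpha.
Proof. by rewrite lfunE. Qed.

Fact inner_der_linear : linear inner_der.
Proof.
move=> c u v; apply/lfunP => alpha; rewrite add_lfunE scale_lfunE !inner_derE.
rewrite mulrDl mulrDr -scalerAl -scalerAr scalerBr.
by rewrite opprD addrACA.
Qed.

HB.instance Definition _ :=
  GRing.isLinear.Build F (grpalg F gT) 'End(grpalg F gT) _ inner_der
    inner_der_linear.

(* See Der_innP: this is exactly { d_beta | beta in F[gT] }.                  *)
Definition Der_inn : {vspace 'End(grpalg F gT)} := limg (linfun inner_der).

Lemma Der_innP (d : 'End(grpalg F gT)) :
  reflect (exists beta, d = inner_der beta) (d \in Der_inn).
Proof.
apply: (iffP memv_imgP) => [[beta _ ->]|[beta ->]].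
  by exists beta; rewrite lfunE.
by exists beta; rewrite ?memvf // lfunE.
Qed.

(* The set { d_g | g in s }, listed without repetition.                       *)
Definition inner_ders (s : seq gT) : seq 'End(grpalg F gT) :=
  undup [seq inner_der (ga_elt g) | g <- s].

End GroupAlgebra.

Local Open Scope group_scope.

Definition V8n_rel (n : nat) (gT : groupType) (a b : gT) : Prop :=
  [/\ a ^+ (2 * n) = 1, b ^+ 4 = 1,
      b * a = a^-1 * b^-1 & b^-1 * a = a^-1 * b].

(* gT = < a, b | a^(2n) = b^4 = 1, ba = a^-1 b^-1, b^-1 a = a^-1 b >, i.e.    *)
(* a, b generate gT, satisfy the relations, and any two elements of any group *)
(* (finite or not) satisfying them are the images of a, b under a morphism.   *)
Definition V8n_presentation (n : nat) (gT : finGroupType) (a b : gT) : Prop :=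
  [/\ <<[set a; b]>> = [set: gT],
      V8n_rel n a b
    & forall (hT : groupType) (x y : hT), V8n_rel n x y ->
      exists f : gT -> hT, [/\ {morph f : u v / u * v}, f a = x & f b = y]].

(* Recall that iota 1 m lists the k with 1 <= k <= m.                         *)
Definition B1_index (n : nat) (gT : groupType) (a b : gT) : seq gT :=
     flatten [seq [:: a ^+ (2 * k); a ^+ (2 * k) * b ^+ 2;
                      a ^+ (4 * k) * b^-1; a ^+ (4 * k + 1) * b^-1;
                      a ^+ (4 * k + 2) * b^-1; a ^+ (4 * k + 3) * b^-1]
             | k <- iota 1 (n %/ 2 - 1)]
  ++ [seq a ^+ (2 * k - 1) | k <- iota 1 n]
  ++ flatten [seq [:: a ^+ (4 * k) * b; a ^+ (4 * k + 1) * b;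
                      a ^+ (4 * k + 2) * b; a ^+ (4 * k + 3) * b]
             | k <- iota 1 (n %/ 2)].

Definition B2_index (n : nat) (gT : groupType) (a b : gT) : seq gT :=
     flatten [seq [:: a ^+ (2 * k); a ^+ (2 * k) * b ^+ 2]
             | k <- iota 1 ((n - 1) %/ 2)]
  ++ flatten [seq [:: a ^+ (2 * k - 1); a ^+ (2 * k) * b;
                      a ^+ (2 * k + 1) * b]
             | k <- iota 1 n]
  ++ flatten [seq [:: a ^+ (2 * k) * b^-1; a ^+ (2 * k + 1) * b^-1]
             | k <- iota 1 (n - 1)].

(* Main.v *)
(** If [r] sends every element of a finite group to a representative of its
    conjugacy class, then the [d_g] with [r g <> g] form a basis of the inner
    derivations: the kernel of [beta |-> d_beta] consists of the class functions,
    so a class function vanishing at all representatives is [0] (independence),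
    and since class sums are central each [d_(r g)] is minus the sum of the other
    [d_x], [x] in the class (generation).  For [V_8n] the elements are the
    [a ^ i b ^ k] with [i < 2n], [k < 4], all distinct because the presentation
    maps onto an explicit permutation group; the class representatives are
    computed in these coordinates, and a count shows that the listed indices are
    exactly the elements that are not representatives. *)

Require Import Defs.
From HB Require Import structures.
From mathcomp Require Import all_boot all_order all_algebra all_fingroup zify.

Set Implicit Arguments.
Unset Strict Implicit.
Unset Printing Implicit Defensive.

Import GRing.Theory.

(** * Linear independence of a family indexed by a finite set *)

Lemma free_image (K : fieldType) (V : vectType K) (I : finType) (A : {set I})
    (f : I -> V) :
    (forall c : I -> K, (\sum_(i in A) c i *: f i = 0)%R ->
       {in A, forall i, c i = 0%R}) ->
  free [seq f i | i <- enum A].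
Proof.
move=> f_indep; change (is_true (free (image_tuple f (mem A)))); apply/freeP => k sum0 i.
(* [enum_rank_in] requires a proof of membership in [A], hence the match; the coefficients are
   extended by 0 outside [A]. *)
pose c x : K := if (x \in A) =P true is ReflectT xA then k (enum_rank_in xA x) else 0%R.
have cE j : c (enum_val j) = k j.
  rewrite /c; case: eqP => [xA|]; first by rewrite enum_valK_in.
  by have := enum_valP j => ->.
rewrite -cE f_indep //; last exact: enum_valP.
rewrite -[RHS]sum0 big_enum_val /=; apply: eq_bigr => j _.
by rewrite cE nth_image.
Qed.

(** * Inner derivations of a group algebra and class representatives *)

Section Transversal.
Local Open Scope ring_scope.
Variables (F : fieldType) (gT : finGroupType).
Implicit Types (u : grpalg F gT) (g h x : gT).

Lemma ga_sumE u : u = \sum_g (u g : F) *: ga_elt F g.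
Proof.
apply/ffunP => x; rewrite sum_ffunE (bigD1 x) //= big1 => [|g gx].
  by rewrite !ffunE eqxx addr0 /GRing.scale /= mulr1.
by rewrite !ffunE eq_sym (negPf gx) scaler0.
Qed.

Lemma ga_mul_eltl g u x : (ga_elt F g * u) x = u (g^-1 * x)%g.
Proof.
rewrite ffunE (bigD1 g) //= big1 => [|h /negPf hg].
  by rewrite ffunE eqxx mul1r addr0.
by rewrite ffunE hg mul0r.
Qed.

Lemma ga_mul_eltr g u x : (u * ga_elt F g) x = u (x * g^-1)%g.
Proof.
rewrite ffunE (bigD1 (x * g^-1)%g) //= big1 => [|h hx].
  by rewrite ffunE invMg invgK mulgKV eqxx mulr1 addr0.
rewrite ffunE -(inj_eq (mulgI h)) mulKVg -(inj_eq (mulIg g^-1%g)) mulgK.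
by rewrite eq_sym (negPf hx) mulr0.
Qed.

(** Comparing the coefficients of [h u] and [u h] at [g h] gives invariance under conjugation;
    conversely, invariance matches the two convolutions term by term. *)
Lemma inner_der0P u :
  reflect (forall g h, u (g ^ h)%g = u g) (inner_der u == 0).
Proof.
apply: (iffP eqP) => [du0 g h | uJ].
  have := congr1 (fun d : 'End(grpalg F gT) => d (ga_elt F h)) du0.
  rewrite inner_derE zero_lfunE => /eqP; rewrite subr_eq0 => /eqP.
  by move/ffunP/(_ (g * h)%g); rewrite ga_mul_eltl ga_mul_eltr mulgK.
apply/lfunP => v; rewrite inner_derE zero_lfunE; apply/eqP; rewrite subr_eq0.
apply/eqP/ffunP => x; rewrite !ffunE.
(* Substituting [x h^-1] for [h] leaves [u] evaluated at [h^-1 x] and at [x h^-1], which are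
   conjugate by [h]. *)
rewrite [RHS](reindex_inj (inj_comp (mulgI x) invg_inj)) /=.
apply: eq_bigr => h _; rewrite [RHS]mulrC invMg invgK mulgKV.
by rewrite -(uJ _ h^-1%g) /conjg invgK !mulgA mulgV mul1g.
Qed.

Lemma inner_derZ (c : F) u : inner_der (c *: u) = c *: inner_der u.
Proof.
apply/lfunP => v; rewrite scale_lfunE !inner_derE -scalerAl -scalerAr.
by rewrite scalerBr.
Qed.

Lemma inner_der_combination (P : pred gT) (k : gT -> F) :
  inner_der (\sum_(g | P g) k g *: ga_elt F g)
    = \sum_(g | P g) k g *: inner_der (ga_elt F g).
Proof.
rewrite (raddf_sum (@inner_der F gT)); apply: eq_bigr => g _.
exact: inner_derZ.
Qed.

Variable r : gT -> gT.
Hypothesis r_class : forall g, exists h, r g = (g ^ h)%g.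
Hypothesis rJ : forall g h, r (g ^ h)%g = r g.

Let S := [set g | r g != g].

Lemma transversal_idem g : r (r g) = r g.
Proof. by have [h rE] := r_class g; rewrite [in LHS]rE rJ. Qed.

(** A vanishing combination yields a class function [u] supported on [S]. Since [r] is idempotent,
    [r g] lies outside [S], so [u g = u (r g) = 0]. *)
Lemma inner_der_transversal_free :
  free [seq inner_der (ga_elt F g) | g <- enum S].
Proof.
apply: free_image => k sum0 g gS.
pose u : grpalg F gT := \sum_(x in S) k x *: ga_elt F x.
have uE x : u x = if x \in S then k x else 0.
  rewrite sum_ffunE; have [xS|xS] := ifPn.
    rewrite (bigD1 x) //= !ffunE eqxx big1 ?addr0 ?[LHS]mulr1 // => y /andP[_ yx].
    by rewrite !ffunE eq_sym (negPf yx) scaler0.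
  rewrite big1 // => y yS; rewrite !ffunE; case: eqP => [xy|_]; last exact: scaler0.
  by rewrite xy yS in xS.
have /eqP/inner_der0P uJ : inner_der u = 0.
  by rewrite inner_der_combination.
have [h rE] := r_class g; have := uJ g h.
by rewrite -rE !uE gS inE transversal_idem eqxx.
Qed.

Lemma inner_der_transversal_basis :
  basis_of (Der_inn F gT) [seq inner_der (ga_elt F g) | g <- enum S].
Proof.
rewrite /basis_of inner_der_transversal_free andbT eqEsubv.
set X := map _ _.
have DS g : g \in S -> inner_der (ga_elt F g) \in <<X>>%VS.
  by move=> gS; apply/memv_span/map_f; rewrite mem_enum.
have DX g : inner_der (ga_elt F g) \in <<X>>%VS.
  have [/DS //|] := boolP (g \in S); rewrite inE negbK => /eqP rg.
  (* For a representative [g], the fibre of [r] over [g] is its conjugacy class, so [u] is a class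
     sum; its term at [g] is then isolated. *)
  pose u : grpalg F gT := [ffun x => (r x == g)%:R : F^o].
  have : inner_der u = 0 by apply/eqP/inner_der0P => x h; rewrite !ffunE rJ.
  rewrite [u]ga_sumE inner_der_combination (bigD1 g) //= ffunE rg eqxx scale1r.
  move/eqP; rewrite addr_eq0 => /eqP ->; rewrite rpredN.
  apply: rpred_sum => x xg; rewrite ffunE.
  case: eqP => [rx|_]; last by rewrite scale0r mem0v.
  by rewrite scale1r DS // inE rx eq_sym.
apply/andP; split.
  apply/span_subvP => d /mapP[g _ ->]; apply/Der_innP; by exists (ga_elt F g).
apply/subvP => d /Der_innP[u ->]; rewrite [u]ga_sumE inner_der_combination.
by apply: rpred_sum => g _; apply: rpredZ.
Qed.

Lemma dim_Der_inn_transversal : \dim (Der_inn F gT) = #|S|.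
Proof. by rewrite (size_basis (X := in_tuple _) inner_der_transversal_basis) size_map cardE. Qed.

(** A list of length [#|S|] containing [S] has exactly the elements of [S], so a concrete list only
    needs an inclusion and a length count. *)
Lemma inner_ders_transversal_basis (s : seq gT) :
    {subset S <= s} -> size s = #|S| ->
  basis_of (Der_inn F gT) (inner_ders F s).
Proof.
move=> sSs szs; rewrite (perm_basis (Y := [seq inner_der (ga_elt F g) | g <- enum S])).
  exact: inner_der_transversal_basis.
have sSs' : {subset enum S <= s} by move=> g; rewrite mem_enum => /sSs.
have [|_ sE] := uniq_min_size (enum_uniq S) sSs'; first by rewrite szs -cardE.
apply: uniq_perm; rewrite ?undup_uniq ?(free_uniq inner_der_transversal_free) //.
by move=> d; rewrite mem_undup; apply/esym/eq_mem_map.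
Qed.

End Transversal.

(** * Multiplication and conjugation rules derived from the relations *)

Section V8nRel.
Local Open Scope group_scope.
Variables (n : nat) (gT : finGroupType) (a b : gT).
Hypothesis rel_ab : V8n_rel n a b.

Definition V8n_elt i k : gT := a ^+ i * b ^+ k.

Lemma V8n_elt_mod i k i' k' :
  i = i' %[mod 2 * n] -> k = k' %[mod 4] -> V8n_elt i k = V8n_elt i' k'.
Proof.
case: rel_ab => a2n b4 _ _ ii' kk'; rewrite /V8n_elt.
by rewrite -(expg_mod i a2n) ii' -(expg_mod k b4) kk' !expg_mod.
Qed.

(** The relations give [b a^-1 = a b^-1], whence [b^2 a = b a^-1 b^-1 = a b^-2 = a b^2]. *)
Lemma V8n_commute_b2a q m : commute (b ^+ (2 * q)) (a ^+ m).
Proof.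
suffices b2a : commute (b ^+ 2) a.
  by rewrite expgnA; apply/commuteX/commute_sym/commuteX/commute_sym.
case: rel_ab => _ b4 ba bVa; have bVV : b * a^-1 = a * b^-1.
  by apply: (mulIg a); rewrite mulgKV -mulgA bVa mulKVg.
rewrite /commute expg2 -mulgA ba mulgA bVV -mulgA; congr (_ * _).
by rewrite -invMg; apply/eqP; rewrite eq_invg_mul -!mulgA; apply/eqP.
Qed.

(** Since [b a = a^-1 b^3] and [b^2] is central, each [a] moved across [b] is inverted and adds 2 to
    the exponent of [b]. *)
Lemma V8n_mul_ba m : b * a ^+ m = a ^- m * b ^+ (2 * m).+1.
Proof.
elim: m => [|m IH]; first by rewrite muln0 !expg0 invg1 mul1g mulg1.
case: rel_ab => _ b4 ba _.
have bV : b^-1 = b ^+ 3 by apply/eqP; rewrite eq_invg_mul -expgS b4.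
have /commuteV cb := V8n_commute_b2a m 1; rewrite expg1 in cb.
rewrite [in LHS]expgSr mulgA {}IH -mulgA [b ^+ _.+1]expgSr -mulgA ba.
rewrite [b ^+ (2 * m) * _]mulgA cb [a ^+ _.+1]expgS invMg -!mulgA bV -expgnDr.
by congr (_ * (_ * _ ^+ _)); lia.
Qed.

Lemma V8n_mul_odd k m : odd k -> b ^+ k * a ^+ m = a ^- m * b ^+ (k + 2 * m).
Proof.
move=> k_odd; have -> : k = (2 * k./2).+1 by lia.
have /commuteV cb := V8n_commute_b2a k./2 m.
rewrite [in LHS]expgSr -mulgA V8n_mul_ba mulgA cb -mulgA -expgnDr.
by congr (_ * _ ^+ _); lia.
Qed.

Lemma V8n_mul_even k m : ~~ odd k -> b ^+ k * a ^+ m = a ^+ m * b ^+ k.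
Proof.
move=> k_even; have -> : k = (2 * k./2)%N by lia.
exact: V8n_commute_b2a.
Qed.

(** For odd [k], conjugating by [a] lowers the exponent of [a] by 2 and exchanges [b] and [b^-1].
    Starting from [i + 2 * m] avoids truncated subtraction. *)
Lemma V8n_conj_odd i k m :
  odd k -> V8n_elt (i + 2 * m) k ^ (a ^+ m) = V8n_elt i (k + 2 * m).
Proof.
move=> k_odd; rewrite conjgE /V8n_elt -!mulgA V8n_mul_odd //.
by rewrite mul2n -addnn addnCA !expgnDr -!mulgA mulKg mulKVg.
Qed.

Lemma V8n_conja_even i k : ~~ odd k -> V8n_elt i k ^ a = V8n_elt i k.
Proof.
move=> k_even; have := V8n_mul_even 1 k_even; rewrite expg1 => ka.
by rewrite conjgE /V8n_elt -!mulgA ka; rewrite [a ^+ i * (a * _)]mulgA -expgSr expgS -mulgA mulKg.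
Qed.

Lemma V8n_conjb i k : i <= 2 * n ->
  V8n_elt i k ^ b = V8n_elt (2 * n - i) (k + 2 * i).
Proof.
move=> le_i; case: (rel_ab) => a2n b4 _ _.
have bV : b^-1 = b ^+ 3 by apply/eqP; rewrite eq_invg_mul -expgS b4.
have aV : a ^- i = a ^+ (2 * n - i).
  by apply/eqP; rewrite eq_invg_mul -expgnDr subnKC // a2n.
have b3a := V8n_mul_odd i (isT : odd 3).
rewrite conjgE bV /V8n_elt !mulgA b3a aV -!(mulgA (a ^+ _)) -mulgA -expgSr -expgnDr.
congr (_ * _); rewrite -[LHS](expg_mod _ b4).
by rewrite -[RHS](expg_mod _ b4); congr (_ ^+ _); lia.
Qed.

End V8nRel.

(* The right regular representation: [a ^ i b ^ k a] is [a ^ (i + 1) b ^ k] for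
   [k] even and [a ^ (i - 1) b ^ (- k)] for [k] odd. *)
Section V8nModel.
Local Open Scope ring_scope.
Variable n : nat.
Hypothesis n_gt0 : (0 < n)%N.
Let T := ('Z_(2 * n) * 'Z_4)%type.

Definition V8n_ra (p : T) : T :=
  if odd p.2 then (p.1 - 1, - p.2) else (p.1 + 1, p.2).
Definition V8n_rb (p : T) : T := (p.1, p.2 + 1).

Fact V8n_ra_inj : injective V8n_ra.
Proof.
move=> [i k] [j l]; rewrite /V8n_ra /=.
case: k l => [[|[|[|[|//]]]] k4] [[|[|[|[|//]]]] l4] //= /eqP;
  rewrite xpair_eqE => /andP[/eqP e] // _; move/addIr: e => ->;
  by congr (_, _); apply: val_inj.
Qed.

Fact V8n_rb_inj : injective V8n_rb.
Proof.
move=> [i k] [j l] /eqP; rewrite xpair_eqE => /andP[/eqP /= -> /eqP].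
by move/addIr ->.
Qed.

Definition V8n_rho_a : {perm T} := perm V8n_ra_inj.
Definition V8n_rho_b : {perm T} := perm V8n_rb_inj.

Lemma V8n_rho_aX m (i : 'Z_(2 * n)) : (V8n_rho_a ^+ m)%g (i, 0) = (i + m%:R, 0).
Proof.
rewrite permX; elim: m => [|m IH]; first by rewrite addr0.
by rewrite iterS IH permE /V8n_ra /= -natr1 addrA.
Qed.

Lemma V8n_rho_bX m (p : T) : (V8n_rho_b ^+ m)%g p = (p.1, p.2 + m%:R).
Proof.
rewrite permX; elim: m => [|m IH]; first by rewrite addr0 -surjective_pairing.
by rewrite iterS IH permE /V8n_rb /= -natr1 addrA.
Qed.

Lemma V8n_rho_rel : V8n_rel n V8n_rho_a V8n_rho_b.
Proof.
have b4 : (V8n_rho_b ^+ 4)%g = 1%g.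
  apply/permP => p; rewrite V8n_rho_bX perm1 [_%:R](_ : _ = 0) ?addr0 //.
    by rewrite -surjective_pairing.
  exact: val_inj.
have bV : V8n_rho_b^-1%g = (V8n_rho_b ^+ 3)%g.
  by apply/eqP; rewrite eq_invg_mul -expgS b4.
split=> //.
- apply/permP => -[i k]; rewrite perm1 permX.
  (* For even [k], [- k = k] in ['Z_4], so one formula covers both parities; at [m = 2 * n], which
     is even and zero in ['Z_(2 * n)], it is the identity. *)
  have -> m : iter m V8n_rho_a (i, k) =
      (if odd k then i - m%:R else i + m%:R, if odd m then - k else k).
    elim: m => [|m IH]; first by rewrite addr0 subr0 if_same.
    rewrite iterS IH permE /V8n_ra /= -natr1.
    case: k {IH} => [[|[|[|[|//]]]] k4] /=; case: (odd m) => /=; rewrite ?opprD ?addrA //;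
      by congr (_, _); apply: val_inj.
  rewrite oddM /= (_ : (2 * n)%:R = 0) ?addr0 ?subr0 ?if_same //.
  by apply: pchar_Zp; lia.
(* The relation is checked in the form [a b a b = 1], free of inverses. *)
- apply: (mulgI V8n_rho_a); rewrite mulKVg; apply: (mulIg V8n_rho_b).
  rewrite mulVg; apply/permP => -[i k]; rewrite !permM !permE /V8n_ra /V8n_rb /=.
  case: k => [[|[|[|[|//]]]] k4] /=; rewrite ?addrK ?subrK;
    by congr (_, _); apply: val_inj.
- apply: (mulgI V8n_rho_a); rewrite mulKVg bV; apply/permP => -[i k].
  rewrite !permM !permE /V8n_ra /V8n_rb /=.
  case: k => [[|[|[|[|//]]]] k4] /=; rewrite ?addrK ?subrK;
    by congr (_, _); apply: val_inj.
Qed.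

End V8nModel.

(** * Normal forms and a conjugation-invariant choice of representatives *)

Section V8n.
Local Open Scope group_scope.
Variables (n : nat) (gT : finGroupType) (a b : gT).
Hypothesis n_gt0 : 0 < n.
Hypothesis hV : V8n_presentation n a b.
Local Notation E := (V8n_elt a b).
Let T := ('I_(2 * n) * 'I_4)%type.

Let rel_ab : V8n_rel n a b. Proof. by case: hV. Qed.

(** Under the morphism to the permutation model, the image of [a ^+ i * b ^+ k] sends [(0, 0)] to
    [(i, k)]. *)
Lemma V8n_elt_inj i k i' k' : i < 2 * n -> k < 4 -> i' < 2 * n -> k' < 4 ->
  E i k = E i' k' -> (i, k) = (i', k').
Proof.
move=> lt_i lt_k lt_i' lt_k' eqE; have n2_gt1 : 1 < 2 * n by lia.
have [_ _ /(_ _ _ _ (V8n_rho_rel n_gt0))[f [fM fa fb]]] := hV.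
have f1 : f 1 = 1 by apply: (mulgI (f 1)); rewrite -fM !mulg1.
have fX x m : f (x ^+ m) = f x ^+ m.
  by elim: m => [|m IH]; rewrite ?expg0 // !expgS fM IH.
have := congr1 (fun x => f x (0, 0)%R) eqE.
rewrite !fM !fX fa fb !permM !V8n_rho_aX !V8n_rho_bX /= !GRing.add0r.
case=> /(congr1 val) /= ei /(congr1 val) /= ek.
by move: ei ek; rewrite !val_Zp_nat // !modn_small // => -> ->.
Qed.

(** The products [E i k] form a subgroup containing both generators. *)
Lemma V8n_elt_onto g : exists p : T, g = E p.1 p.2.
Proof.
have n2_gt0 : 0 < 2 * n by lia.
have Eonto i k : exists p : T, E i k = E p.1 p.2.
  exists (Ordinal (ltn_pmod i n2_gt0), Ordinal (ltn_pmod k (isT : 0 < 4))).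
  by apply: (V8n_elt_mod rel_ab); rewrite /= modn_mod.
pose H := [set E p.1 p.2 | p : T].
have EH i k : E i k \in H by have [p ->] := Eonto i k; apply: imset_f.
have aE : a = E 1 0 by rewrite /V8n_elt mulg1.
have bE : b = E 0 1 by rewrite /V8n_elt mul1g.
have H_group : group_set H.
  apply/group_setP; split; first by rewrite (_ : 1 = E 0 0) // /V8n_elt mulg1.
  move=> _ _ /imsetP[[i k] _ ->] /imsetP[[j l] _ ->] /=.
  have [k_odd|k_even] := boolP (odd k).
    have -> : E i k * E j l = E (i + (2 * n - j)) (k + 2 * j + l).
      have [a2n _ _ _] := rel_ab.
      have aV : a ^- j = a ^+ (2 * n - j).
        by apply/eqP; rewrite eq_invg_mul -expgnDr subnKC ?a2n // ltnW.
      rewrite /V8n_elt mulgA -[a ^+ i * _ * _]mulgA (V8n_mul_odd rel_ab) //.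
      by rewrite aV !expgnDr !mulgA.
    exact: EH.
  have -> : E i k * E j l = E (i + j) (k + l).
    rewrite /V8n_elt mulgA -[a ^+ i * _ * _]mulgA (V8n_mul_even rel_ab) //.
    by rewrite !expgnDr !mulgA.
  exact: EH.
have [gen_ab _ _] := hV.
have : g \in Group H_group.
  have : g \in <<[set a; b]>> by rewrite gen_ab inE.
  apply/subsetP; rewrite gen_subG; apply/subsetP => x.
  have [aH bH] : a \in H /\ b \in H by rewrite {1}aE {2}bE !EH.
  by case/set2P => ->.
by case/imsetP => p _ ->; exists p.
Qed.

Definition V8n_coord g : nat * nat :=
  if [pick p : T | g == E p.1 p.2] is Some p then (p.1 : nat, p.2 : nat) else (0, 0).

Lemma V8n_coordP g : let: (i, k) := V8n_coord g in
  [/\ i < 2 * n, k < 4 & g = E i k].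
Proof.
rewrite /V8n_coord; case: pickP => [[i k] /eqP-> | no_p] //=.
by have [p /eqP] := V8n_elt_onto g; rewrite no_p.
Qed.

Lemma V8n_coordE i k : i < 2 * n -> k < 4 -> V8n_coord (E i k) = (i, k).
Proof.
move=> lt_i lt_k; have := V8n_coordP (E i k).
by case: V8n_coord => i' k' [lt_i' lt_k' /V8n_elt_inj->].
Qed.

(** For odd [k], conjugation by [a] moves [(i, k)] to [(i - 2, k + 2)], so [k = 3] can be reached;
    the class invariant is [i] mod 2 if [n] is odd, [i + k] mod 4 if [n] is even. For even [k], [a]
    commutes with the element and [b] sends [(i, k)] to [(- i, k + 2 * i)]: the choice is [k = 2]
    for odd [i], and [i = 0] or [i >= n] for even [i]. *)
Definition V8n_nf i k : nat * nat :=
  if odd k then (if odd n then i %% 2 else (i + k + 1) %% 4, 3)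
  else if odd i then (if k == 0 then 2 * n - i else i, 2)
  else (if 0 < i < n then 2 * n - i else i, k).

Definition V8n_rep g : gT :=
  let: (i, k) := V8n_coord g in let: (j, l) := V8n_nf i k in E j l.

Lemma V8n_repE i k j l : i < 2 * n -> k < 4 -> V8n_nf i k = (j, l) ->
  V8n_rep (E i k) = E j l.
Proof. by move=> lt_i lt_k nfE; rewrite /V8n_rep V8n_coordE // nfE. Qed.

Lemma V8n_rep_conja g : V8n_rep (g ^ a) = V8n_rep g.
Proof.
have := V8n_coordP g; case: V8n_coord => i k [lt_i lt_k ->].
have [k_odd|k_even] := boolP (odd k); last by rewrite (V8n_conja_even rel_ab).
(* These are [i - 2] modulo [2 * n] and [k + 2] modulo 4, reduced to the coordinate range. *)
pose i' := if 2 <= i then i - 2 else i + 2 * n - 2.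
pose k' := if k == 1%N then 3 else 1%N.
have -> : E i k ^ a = E i' k'.
  have -> : E i k = E (i' + 2 * 1) k.
    apply: (V8n_elt_mod rel_ab) => //; rewrite /i'.
    case: ifP => i_ge2; first by rewrite subnK.
    by rewrite subnK ?modnDr //; lia.
  have conj_a := V8n_conj_odd rel_ab i' 1 k_odd; rewrite expg1 in conj_a.
  by rewrite conj_a; apply: (V8n_elt_mod rel_ab) => //; rewrite /k'; case: eqP => ?; lia.
case nfE: (V8n_nf i k) => [j l]; rewrite (V8n_repE lt_i lt_k nfE).
apply: V8n_repE; rewrite /i' /k'; [by case: ifP => ?; lia|by case: eqP|].
rewrite -nfE /V8n_nf k_odd; case: eqP => ? /=; case: ifP => ?; case: ifP => ?;
  by congr (_, _); lia.
Qed.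

Lemma V8n_rep_conjb g : V8n_rep (g ^ b) = V8n_rep g.
Proof.
have := V8n_coordP g; case: V8n_coord => i k [lt_i lt_k ->].
pose i' := if i == 0 then 0 else 2 * n - i.
pose k' := (k + 2 * i) %% 4.
have -> : E i k ^ b = E i' k'.
  rewrite (V8n_conjb rel_ab) ?(ltnW lt_i) //; apply: (V8n_elt_mod rel_ab).
    by rewrite /i'; case: eqP => [->|//]; rewrite subn0 modnn mod0n.
  by rewrite /k' modn_mod.
case nfE: (V8n_nf i k) => [j l]; rewrite (V8n_repE lt_i lt_k nfE).
apply: V8n_repE; rewrite /i' /k'; [by case: eqP => ?; lia|by rewrite ltn_mod|].
rewrite -nfE /V8n_nf; have -> : odd ((k + 2 * i) %% 4) = odd k by lia.
have -> : odd (if i == 0 then 0 else 2 * n - i) = odd i by case: eqP => ?; lia.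
case: ifP => k_odd.
  by congr (_, _); case: ifP => n_odd; case: eqP => ?; lia.
case: ifP => i_odd; first by case: eqP => ?; case: eqP => ?; case: eqP => ?;
  congr (_, _); lia.
have [i0|i_neq0] := eqVneq i 0; first by rewrite i0 /=; congr pair; lia.
(* Either [i] and [2 * n - i] lie on opposite sides of [n], or both equal [n]. *)
by case: (boolP (0 < i < n)); case: (boolP (0 < 2 * n - i < n)) => ? ?; congr pair; lia.
Qed.

End V8n.

(** * Conjugacy class representatives and the number of other elements *)

Section V8nClasses.
Local Open Scope group_scope.
Variables (n : nat) (gT : finGroupType) (a b : gT).
Hypothesis n_gt0 : 0 < n.
Hypothesis hV : V8n_presentation n a b.
Local Notation E := (V8n_elt a b).
Let T := ('I_(2 * n) * 'I_4)%type.

Let rel_ab : V8n_rel n a b. Proof. by case: hV. Qed.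

(** The [h] whose conjugation preserves all representatives form a subgroup, so the generators
    suffice. *)
Lemma V8n_repJ g h : V8n_rep n a b (g ^ h) = V8n_rep n a b g.
Proof.
pose H := [set h | [forall g, V8n_rep n a b (g ^ h) == V8n_rep n a b g]].
have H_group : group_set H.
  apply/group_setP; split; first by rewrite inE; apply/forallP => x; rewrite conjg1.
  move=> x y; rewrite !inE => /forallP Hx /forallP Hy; apply/forallP => z.
  by rewrite conjgM (eqP (Hy _)).
suffices : h \in Group H_group by rewrite inE => /forallP/(_ g)/eqP.
have : h \in <<[set a; b]>> by case: hV => -> _ _; rewrite inE.
apply/subsetP; rewrite gen_subG; apply/subsetP => x.
by case/set2P => ->; rewrite inE; apply/forallP => y; apply/eqP;
  [apply: V8n_rep_conja | apply: V8n_rep_conjb].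
Qed.

Lemma V8n_nf_step i k j : i < 2 * n -> odd k -> k < 4 ->
  V8n_nf n i k = (j, 3) -> exists2 m, i = j + 2 * m %[mod 2 * n] & k + 2 * m = 3 %[mod 4].
Proof.
move=> lt_i k_odd lt_k; rewrite /V8n_nf k_odd; case: ifP => n_odd [<-].
  pose m0 := i %/ 2; have [m0E|m0E] := eqVneq ((k + 2 * m0) %% 4) 3.
    by exists m0 => //; congr (_ %% _); lia.
  (* Adding [n] changes [2 * m] by 0 modulo [2 * n] but, as [n] is odd, by 2 modulo 4. *)
  exists (m0 + n); last by lia.
  by rewrite (_ : _ + 2 * _ = i + 2 * n)%N ?modnDr //; lia.
exists ((i + 2 * n - (i + k + 1) %% 4) %/ 2); last by lia.
by rewrite (_ : _ + 2 * _ = i + 2 * n)%N ?modnDr //; lia.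
Qed.

Lemma V8n_rep_class g : exists h, V8n_rep n a b g = g ^ h.
Proof.
have := V8n_coordP n_gt0 hV g; case: V8n_coord => i k [lt_i lt_k ->].
case nfE: (V8n_nf n i k) => [j l]; rewrite (V8n_repE n_gt0 hV lt_i lt_k nfE).
have [k_odd|k_even] := boolP (odd k).
  have l3 : l = 3 by move: nfE; rewrite /V8n_nf k_odd => -[_ <-].
  rewrite l3 in nfE *; have [m im km] := V8n_nf_step lt_i k_odd lt_k nfE.
  exists (a ^+ m); rewrite (V8n_elt_mod rel_ab im (erefl (k %% 4))).
  rewrite (V8n_conj_odd rel_ab) //.
  exact: (V8n_elt_mod rel_ab (erefl _) (esym km)).
have [[-> ->]|[-> kl]] : j = i /\ l = k \/ j = 2 * n - i /\ l = k + 2 * i %[mod 4].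
- move: nfE; rewrite /V8n_nf (negPf k_even); case: ifP => i_odd [<- <-].
    by case: eqP => k0; [right | left]; split => //; lia.
  by case: ifP => _; [right | left]; split => //; lia.
- by exists 1; rewrite conjg1.
exists b; rewrite (V8n_conjb rel_ab) ?(ltnW lt_i) //.
exact: (V8n_elt_mod rel_ab (erefl _) kl).
Qed.

Lemma V8n_repN i k : i < 2 * n -> k < 4 ->
  (V8n_rep n a b (E i k) != E i k) = (V8n_nf n i k != (i, k)).
Proof.
move=> lt_i lt_k; case nfE: (V8n_nf n i k) => [j l].
rewrite (V8n_repE n_gt0 hV lt_i lt_k nfE); congr (~~ _).
have [lt_j lt_l] : j < 2 * n /\ l < 4.
  move: nfE; rewrite /V8n_nf; case: ifP => k_odd.
    by case: ifP => n_odd [<- <-]; split => //; lia.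
  case: ifP => i_odd [<- <-]; split=> //; first by case: ifP => ?; lia.
  by case: ifP => ?; lia.
by apply/eqP/eqP => [/(V8n_elt_inj n_gt0 hV)-> // | [-> ->]].
Qed.

Lemma card_V8n_nf_moved :
  #|[set p : T | V8n_nf n p.1 p.2 != (p.1 : nat, p.2 : nat)]|
    = (if odd n then 3 * (2 * n - 1) else 6 * (n - 1))%N.
Proof.
pose c := if odd n then 2 else 4.
pose F (i k : nat) := nat_of_bool (V8n_nf n i k != (i, k)).
have -> : #|[set p : T | V8n_nf n p.1 p.2 != (p.1 : nat, p.2 : nat)]|
    = \sum_(i < 2 * n) \sum_(k < 4) F i k.
  rewrite pair_bigA -sum1dep_card big_mkcond; apply: eq_bigr => -[i k] _ /=.
  by rewrite /F; case: (_ != _).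
(* For fixed [i]: [k = 1] always moves, [k = 3] moves when [c <= i], [k = 0] moves for odd [i], and
   [k = 0] and [k = 2] both move for even [i] with [0 < i < n]. *)
have -> : (\sum_(i < 2 * n) \sum_(k < 4) F i k =
    \sum_(i < 2 * n) (1 + (c <= i) + (odd i + 2 * (~~ odd i && (0 < i < n)))))%N.
  have nf3 i : (V8n_nf n i 3 == (i, 3)) = (i < c).
    by rewrite /c /V8n_nf /=; case: ifP => n_odd; rewrite xpair_eqE eqxx andbT; lia.
  have nf_even i : ((if 0 < i < n then 2 * n - i else i) == i) = ~~ (0 < i < n).
    by case: ifP => ?; rewrite ?eqxx; lia.
  apply: eq_bigr => -[i lt_i] _; rewrite !big_ord_recr big_ord0 /= /F nf3 -leqNgt.
  rewrite /V8n_nf /= !xpair_eqE /= addnC; case: odd => /=.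
    by rewrite !xpair_eqE !eqxx andbF; lia.
  by rewrite !xpair_eqE !nf_even !eqxx !andbT negbK; lia.
(* The range is freed from [n] to allow induction, adding one even and one odd [i] at a time; the
   [minn] counts the even [i] with [0 < i < n]. *)
have sumE m : (\sum_(i < 2 * m) (1 + (c <= i) + (odd i + 2 * (~~ odd i && (0 < i < n))))
   = 3 * m + 2 * (m - c %/ 2) + 2 * minn m.-1 (n.-1 %/ 2))%N.
  have ev_c : c = 2 \/ c = 4 by rewrite /c; case: ifP; [left|right].
  elim: m => [|m IH]; first by rewrite big_ord0 min0n.
  rewrite mulnSr addn2 !big_ord_recr /= {}IH oddM /= !muln0 !addn0.
  have -> : (0 < 2 * m < n) = (0 < m <= n.-1 %/ 2) by lia.
  have -> : (c <= (2 * m).+1) = (c %/ 2 <= m) by lia.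
  have -> : (c <= 2 * m) = (c %/ 2 <= m) by lia.
  move: (c %/ 2) (n.-1 %/ 2) => d h {ev_c}.
  have -> : minn m h = minn m.-1 h + (0 < m <= h).
    case: m => [|m] /=; rewrite ?min0n //; have [mh|hm] := ltnP m h.
      by rewrite (minn_idPl mh) addn1.
    by rewrite (minn_idPr (leqW hm)) addn0.
  have -> : m.+1 - d = m - d + (d <= m) by case: leqP; lia.
  lia.
rewrite sumE /c; have [?|?] := boolP (odd n); lia.
Qed.

Lemma card_V8n_moved :
  #|[set g | V8n_rep n a b g != g]| = (if odd n then 3 * (2 * n - 1) else 6 * (n - 1))%N.
Proof.
rewrite -card_V8n_nf_moved.
rewrite -(card_imset _ (_ : injective (fun p : T => E p.1 p.2))); last first.
  move=> [[i lt_i] [k lt_k]] [[j lt_j] [l lt_l]] /=.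
  by case/(V8n_elt_inj n_gt0 hV lt_i lt_k lt_j lt_l) => ij kl; congr (_, _); apply: val_inj.
apply: eq_card => g; apply/idP/imsetP => [|[p pS ->]]; last first.
  by move: pS; rewrite !inE V8n_repN.
have [p ->] := V8n_elt_onto n_gt0 hV g; rewrite inE V8n_repN // => pS.
by exists p; rewrite ?inE.
Qed.

End V8nClasses.

(** * The index lists: lengths and coverage of the non-representatives *)

Lemma size_flatten_const (T I : Type) (m : nat) (f : I -> seq T) s :
  (forall i, size (f i) = m) -> size (flatten [seq f i | i <- s]) = (m * size s)%N.
Proof. by move=> fm; elim: s => [|i s IH] /=; rewrite ?muln0 // size_cat fm IH mulnS. Qed.

Section V8nIndex.
Local Open Scope group_scope.
Variables (n : nat) (gT : finGroupType) (a b : gT).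
Hypothesis n_gt0 : 0 < n.
Hypothesis hV : V8n_presentation n a b.
Local Notation E := (V8n_elt a b).

Let rel_ab : V8n_rel n a b. Proof. by case: hV. Qed.

Lemma size_B1_index : ~~ odd n -> size (B1_index n a b) = (6 * (n - 1))%N.
Proof.
move=> n_even; rewrite !size_cat (size_flatten_const (m := 6)) //.
rewrite (size_flatten_const (m := 4)) // size_map !size_iota; lia.
Qed.

Lemma size_B2_index : odd n -> size (B2_index n a b) = (3 * (2 * n - 1))%N.
Proof.
move=> n_odd; rewrite !size_cat (size_flatten_const (m := 2)) //.
rewrite (size_flatten_const (m := 3)) // (size_flatten_const (m := 2)) //.
rewrite !size_iota; lia.
Qed.

Lemma V8n_elt0 i : E i 0 = a ^+ i. Proof. exact: mulg1. Qed.

Lemma V8n_elt3 i : E i 3 = a ^+ i * b^-1.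
Proof.
case: rel_ab => _ b4 _ _; congr (_ * _).
by apply/esym/eqP; rewrite eq_invg_mul -expgS b4.
Qed.

(** The four alternatives correspond to the blocks of the index lists. *)
Lemma V8n_moved_coord i k : i < 2 * n -> k < 4 -> V8n_nf n i k != (i, k) ->
  [\/ k = 1%N, k = 3 /\ (if odd n then 2 else 4) <= i, k = 0 /\ odd i
    | (k = 0 \/ k = 2) /\ ~~ odd i && (0 < i < n)].
Proof.
move=> lt_i lt_k.
case: k lt_k => [|[|[|[|//]]]] _; rewrite /V8n_nf /=.
- case: ifP => i_odd; first by constructor 3.
  by case: ifP => i_n; rewrite ?eqxx // => _; constructor 4; split; [left|].
- by constructor 1.
- case: ifP => i_odd; first by rewrite eqxx.
  by case: ifP => i_n; rewrite ?eqxx // => _; constructor 4; split; [right|].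
- rewrite xpair_eqE eqxx andbT => i_c; constructor 2; split=> //.
  by move: i_c; case: ifP => n_odd; lia.
Qed.

Lemma B1_index_moved : ~~ odd n ->
  {subset [set g | V8n_rep n a b g != g] <= B1_index n a b}.
Proof.
move=> n_even g; have := V8n_coordP n_gt0 hV g.
case: V8n_coord => i k [lt_i lt_k ->]; rewrite inE V8n_repN //.
case/(V8n_moved_coord lt_i lt_k); rewrite ?(negPf n_even).
- move=> ->; rewrite !mem_cat; apply/orP; right; apply/orP; right.
  (* The block starts at index 1, so [i < 4] is found at the other end, as
     [i + 2 * n = 4 * (n %/ 2) + i]. *)
  pose q := if i %/ 4 == 0 then n %/ 2 else i %/ 4.
  have iq : i = 4 * q + i %% 4 %[mod 2 * n].
    rewrite /q; case: eqP => q0; last by congr (_ %% _); lia.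
    by rewrite (_ : _ + _ = i + 2 * n)%N ?modnDr //; lia.
  apply/flatten_mapP; exists q; first by rewrite mem_iota /q; case: eqP => ?; lia.
  rewrite (V8n_elt_mod rel_ab iq (erefl (1 %% 4))) !inE /V8n_elt.
  case: (i %% 4) (ltn_mod i 4) => [|[|[|[|//]]]] _;
    by rewrite ?addn0 eqxx ?orbT.
- case=> -> i_ge4; rewrite !mem_cat; apply/orP; left.
  apply/flatten_mapP; exists (i %/ 4); first by rewrite mem_iota; lia.
  rewrite V8n_elt3 {1}(_ : i = 4 * (i %/ 4) + i %% 4)%N; last by lia.
  rewrite !inE; case: (i %% 4) (ltn_mod i 4) => [|[|[|[|//]]]] _;
    by rewrite ?addn0 eqxx ?orbT.
- case=> -> i_odd; rewrite !mem_cat; apply/orP; right; apply/orP; left.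
  apply/mapP; exists (i.+1 %/ 2); first by rewrite mem_iota; lia.
  by rewrite V8n_elt0; congr (_ ^+ _); lia.
case=> k02 /andP[i_even i_n]; rewrite !mem_cat; apply/orP; left.
apply/flatten_mapP; exists (i %/ 2); first by rewrite mem_iota; lia.
rewrite !inE; have <- : i = (2 * (i %/ 2))%N by lia.
by case: k02 => ->; rewrite ?V8n_elt0 /V8n_elt eqxx ?orbT.
Qed.

Lemma B2_index_moved : odd n ->
  {subset [set g | V8n_rep n a b g != g] <= B2_index n a b}.
Proof.
move=> n_odd g; have := V8n_coordP n_gt0 hV g.
case: V8n_coord => i k [lt_i lt_k ->]; rewrite inE V8n_repN //.
case/(V8n_moved_coord lt_i lt_k); rewrite ?n_odd.
- move=> ->; rewrite !mem_cat; apply/orP; right; apply/orP; left.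
  (* Here [i < 2] is listed as [2 * n + i], at index [n]. *)
  pose q := if i %/ 2 == 0 then n else i %/ 2.
  have iq : i = 2 * q + i %% 2 %[mod 2 * n].
    rewrite /q; case: eqP => q0; last by congr (_ %% _); lia.
    by rewrite (_ : _ + _ = i + 2 * n)%N ?modnDr //; lia.
  apply/flatten_mapP; exists q; first by rewrite mem_iota /q; case: eqP => ?; lia.
  rewrite (V8n_elt_mod rel_ab iq (erefl (1 %% 4))) !inE /V8n_elt.
  case: (i %% 2) (ltn_mod i 2) => [|[|//]] _;
    by rewrite ?addn0 eqxx ?orbT.
- case=> -> i_ge2; rewrite !mem_cat; apply/orP; right; apply/orP; right.
  apply/flatten_mapP; exists (i %/ 2); first by rewrite mem_iota; lia.
  rewrite V8n_elt3 {1}(_ : i = 2 * (i %/ 2) + i %% 2)%N; last by lia.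
  rewrite !inE; case: (i %% 2) (ltn_mod i 2) => [|[|//]] _;
    by rewrite ?addn0 eqxx ?orbT.
- case=> -> i_odd; rewrite !mem_cat; apply/orP; right; apply/orP; left.
  apply/flatten_mapP; exists (i.+1 %/ 2); first by rewrite mem_iota; lia.
  rewrite !inE V8n_elt0; have <- : i = (2 * (i.+1 %/ 2) - 1)%N by lia.
  by rewrite eqxx.
case=> k02 /andP[i_even i_n]; rewrite !mem_cat; apply/orP; left.
apply/flatten_mapP; exists (i %/ 2); first by rewrite mem_iota; lia.
rewrite !inE; have <- : i = (2 * (i %/ 2))%N by lia.
by case: k02 => ->; rewrite ?V8n_elt0 /V8n_elt eqxx ?orbT.
Qed.

End V8nIndex.

Theorem proposition3p3 (F : fieldType) (n : nat) (n_gt0 : 0 < n)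
    (gT : finGroupType) (a b : gT) (hV : V8n_presentation n a b) :
  [/\ \dim (Der_inn F gT) =
        (if odd n then 3 * (2 * n - 1) else 6 * (n - 1))%N,
      ~~ odd n ->
        basis_of (Der_inn F gT) (inner_ders F (B1_index n a b))
    & odd n ->
        basis_of (Der_inn F gT) (inner_ders F (B2_index n a b))].
Proof.
have rP := V8n_rep_class n_gt0 hV; have rJ := V8n_repJ n_gt0 hV.
have cardS := card_V8n_moved n_gt0 hV.
split=> [|n_even|n_odd].
- by rewrite (dim_Der_inn_transversal F rP rJ).
- apply: (inner_ders_transversal_basis F rP rJ).
    exact: B1_index_moved.
  by rewrite size_B1_index // cardS (negPf n_even).
- apply: (inner_ders_transversal_basis F rP rJ).
    exact: B2_index_moved.
  by rewrite size_B2_index // cardS n_odd.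
Qed.
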